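(* Let $(N,T,f)$ be a game ladder and $p,q\in N$. If $p\succeq q$, then $|\mathcal{R}^+_{ip}(f)|\ge|\mathcal{R}^+_{iq}(f)|$ for every $i\in\{1,\dots,k-1\}$.
   Context: A game ladder is a triple $(N,T,f)$ where $N=\{1,\dots,n\}$ is a non-empty finite set of players, $T=\{1,\dots,m\}$ with $m\ge 2$ is an ordered set of positions (higher index = more important position), and $f:T^N\to\mathbb{R}$ is monotonic: for all $x,z\in T^N$ with $x\le z$ componentwise, $f(x)\le f(z)$. For $p\in N$, $e^p$ denotes the $p$-th unit vector. For players $p,q$ and positions $r>s$ in $T$, write $p\succeq_{(r,s)}q$ if for every $x\in T^N$ with $x_p=x_q=s$ one has $f(x+(r-s)e^p)\ge f(x+(r-s)e^q)$; write $p\succeq q$ if $p\succeq_{(r,s)}q$ for all $r>s$ in $T$. Let $z_1>z_2>\dots>z_k$ be the distinct values in the range of $f$. An ordered allocation of positions is a pair $R=(\sigma,x)$ with $\sigma:N\to\{1,\dots,n\}$ a bijection (the order in which players act) and $x\in T^N$. For a player $a$, let $\mathcal{A}(R,a)$ be the set of ordered allocations $(\sigma,y)$ with the same $\sigma$ and $y_b=x_b$ for all $b$ with $\sigma(b)\le\sigma(a)$; if $\sigma(a)\ne 1$, let $\mathrm{prec}(a)$ be the player $b$ with $\sigma(b)=\sigma(a)-1$. For $i\in\{1,\dots,k-1\}$, player $a$ is $i$-pivotal in $R$ if either (1) $f(y)\ge z_i$ for all $(\sigma,y)\in\mathcal{A}(R,a)$ and, if $\sigma(a)\ne1$, there is $(\sigma,y)\in\mathcal{A}(R,\mathrm{prec}(a))$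 with $f(y)<z_i$; or (2) $f(y)<z_i$ for all $(\sigma,y)\in\mathcal{A}(R,a)$ and, if $\sigma(a)\ne1$, there is $(\sigma,y)\in\mathcal{A}(R,\mathrm{prec}(a))$ with $f(y)\ge z_i$. $\mathcal{R}^+_{ia}(f)$ denotes the set of all ordered allocations of positions in which $a$ is $i$-pivotal. *)

(* Defs.v *)
From mathcomp Require Import all_boot all_order all_algebra all_fingroup.
From mathcomp Require Import reals.
Set Implicit Arguments.
Unset Strict Implicit.
Unset Printing Implicit Defensive.
Import Order.TTheory GRing.Theory Num.Theory.
Local Open Scope ring_scope.

(** Players [{1, ..., n}] and positions [{1, ..., m}] are
    represented by ['I_n] and ['I_m], so all labels are shifted down by one. *)

Notation allocation n m := {ffun 'I_n -> 'I_m}.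

Record game_ladder (R : realType) (n m : nat) := GameLadder {
  ladder_fun :> allocation n m -> R;
  players_gt0 : (0 < n)%N;
  positions_gt1 : (1 < m)%N;
  ladder_monotonic : forall x z : allocation n m,
    (forall b : 'I_n, (x b <= z b)%N) -> ladder_fun x <= ladder_fun z }.

(** For [x p = s] and [s < r], [reassign x p r] is [x + (r - s) e^p]
    (see [reassignE]). *)
Definition reassign (n m : nat) (x : allocation n m) (p : 'I_n) (r : 'I_m) :
    allocation n m :=
  [ffun b => if b == p then r else x b].

Lemma reassignE (n m : nat) (x : allocation n m) (p : 'I_n) (r s : 'I_m) :
  x p = s -> (s < r)%N ->
  forall b, reassign x p r b = (x b + (r - s) * (b == p))%N :> nat.
Proof.
move=> xps lt_sr b; rewrite ffunE; case: eqVneq => [->|_].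
  by rewrite muln1 xps subnKC // ltnW.
by rewrite muln0 addn0.
Qed.

Section Desirability.
Variables (R : realType) (n m : nat) (f : game_ladder R n m).

Definition succeq_at (r s : 'I_m) (p q : 'I_n) : Prop :=
  forall x : allocation n m, x p = s -> x q = s ->
    f (reassign x p r) >= f (reassign x q r).

Definition succeq (p q : 'I_n) : Prop :=
  forall r s : 'I_m, (s < r)%N -> succeq_at r s p q.

End Desirability.

(** [(sigma, x)], where [sigma a] is the (0-based) rank at which [a] acts. *)
Notation ordered_allocation n m := ({perm 'I_n} * allocation n m)%type.

Section Pivotality.
Variables (R : realType) (n m : nat) (f : game_ladder R n m).

Definition values : seq R := sort >=%R (undup (codom f)).

Lemma values_decreasing : sorted >%R values.
Proof.
have ge_values : sorted >=%R values.
  by apply: sort_sorted => x y; apply: le_total.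
rewrite -[values]revK rev_sorted lt_sorted_uniq_le rev_uniq sort_uniq.
by rewrite undup_uniq /= rev_sorted.
Qed.

Lemma mem_values (v : R) : (v \in values) = (v \in codom f).
Proof. by rewrite mem_sort mem_undup. Qed.

Definition nvalues : nat := size values.

(** [z_1 > ... > z_k] is numbered from 1; the default [0] is never reached for
    [1 <= i <= nvalues]. *)
Definition z (i : nat) : R := nth 0 values i.-1.

Definition consistent (Q : ordered_allocation n m) (a : 'I_n) :
    {set ordered_allocation n m} :=
  [set Q' : ordered_allocation n m | (Q'.1 == Q.1) &&
    [forall b : 'I_n, (Q.1 b <= Q.1 a)%N ==> (Q'.2 b == Q.2 b)]].

(** Only meaningful when [a] is not the first player: [ord_pred] wraps around
    at rank 0. *)
Definition prec (sigma : {perm 'I_n}) (a : 'I_n) : 'I_n :=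
  (sigma^-1)%g (ord_pred (sigma a)).

Lemma prec_rank (sigma : {perm 'I_n}) (a : 'I_n) :
  (sigma a != 0 :> nat)%N -> sigma (prec sigma a) = (sigma a).-1 :> nat.
Proof.
rewrite /prec permKV /=; case: (sigma a) => [[|k] ltkn] //= _.
by rewrite modnDr modn_small // ltnW.
Qed.

Definition pivotal (i : nat) (Q : ordered_allocation n m) (a : 'I_n) : bool :=
  ([forall Q' in consistent Q a, f Q'.2 >= z i] &&
   ((Q.1 a != 0 :> nat)%N ==>
     [exists Q' in consistent Q (prec Q.1 a), f Q'.2 < z i]))
  ||
  ([forall Q' in consistent Q a, f Q'.2 < z i] &&
   ((Q.1 a != 0 :> nat)%N ==>
     [exists Q' in consistent Q (prec Q.1 a), f Q'.2 >= z i])).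

Definition Rplus (i : nat) (a : 'I_n) : {set ordered_allocation n m} :=
  [set Q : ordered_allocation n m | pivotal i Q a].

End Pivotality.

(* Main.v *)
Require Import Defs.
From mathcomp Require Import all_boot all_order all_algebra all_fingroup.
From mathcomp Require Import reals.

(** Call [x] decided on a set [S] of players when the positions [x] gives to
    [S] already settle whether the value reaches [z_i].  Player [a] is pivotal
    iff [x] is decided once [a] has acted but not before, so the number of
    ordered allocations in which [a] is pivotal is a difference of two numbers
    of decided ones.  One injection, which exchanges the ranks of [p] and [q]
    and, when [q] acts before [p], also their positions, shows that being
    decided up to [q] is at most as frequent as being decided up to [p], and
    that being decided before [p] is at most as frequent as being decided
    before [q]. *)

Import Order.TTheory GRing.Theory Num.Theory.
Local Open Scope ring_scope.

(** * Outcomes settled by the positions of a set of players *)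

Section Decided.
Context {R : realType} {n m : nat} (f : game_ladder R n m) (c : R).
Implicit Types (S : {set 'I_n}) (x y : allocation n m) (p q a b : 'I_n).
Implicit Types (s : {perm 'I_n}) (Q : ordered_allocation n m).

Definition agree S x y : bool := [forall b in S, y b == x b].

Lemma agreeP {S x y} : reflect {in S, y =1 x} (agree S x y).
Proof. exact: 'forall_in_eqP. Qed.

Lemma agree_refl S x : agree S x x.
Proof. exact/agreeP. Qed.

Lemma agree_subset S S' x y : S \subset S' -> agree S' x y -> agree S x y.
Proof. by move=> /subsetP sSS' /agreeP xy; apply/agreeP=> b /sSS'/xy. Qed.

Definition always_ge S x : bool := [forall y, agree S x y ==> (c <= f y)].
Definition always_lt S x : bool := [forall y, agree S x y ==> (f y < c)].
Definition decided S x : bool := always_ge S x || always_lt S x.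

Lemma always_geP {S x} :
  reflect (forall y, agree S x y -> c <= f y) (always_ge S x).
Proof. exact: 'forall_implyP. Qed.

Lemma always_ltP {S x} :
  reflect (forall y, agree S x y -> f y < c) (always_lt S x).
Proof. exact: 'forall_implyP. Qed.

Lemma always_ge_subset S S' x :
  S \subset S' -> always_ge S x -> always_ge S' x.
Proof.
move=> sSS' /always_geP geS; apply/always_geP=> y xy.
exact/geS/(agree_subset _ _ _ _ sSS').
Qed.

Lemma always_lt_subset S S' x :
  S \subset S' -> always_lt S x -> always_lt S' x.
Proof.
move=> sSS' /always_ltP ltS; apply/always_ltP=> y xy.
exact/ltS/(agree_subset _ _ _ _ sSS').
Qed.

Lemma decided_subset S S' x : S \subset S' -> decided S x -> decided S' x.
Proof.
by move=> sSS' /orP[/(always_ge_subset _ _ _ sSS')|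
  /(always_lt_subset _ _ _ sSS')] dS'; rewrite /decided dS' ?orbT.
Qed.

(** Whatever the two sets, [x] agrees with itself on both, and its value cannot lie on both sides of
    [c]. *)
Lemma always_ge_ltF S S' x : always_ge S x -> always_lt S' x = false.
Proof.
move=> /always_geP/(_ x (agree_refl _ _)) ge_c; apply/negP.
by move=> /always_ltP/(_ x (agree_refl _ _)); rewrite ltNge ge_c.
Qed.

(** * Exchanging the positions of two players *)

Definition swap_positions p q x : allocation n m :=
  [ffun b => x (tperm p q b)].

Lemma swap_positionsK p q : involutive (swap_positions p q).
Proof. by move=> x; apply/ffunP=> b; rewrite !ffunE tpermK. Qed.

Lemma swap_positions_le p q y :
  succeq f p q -> p != q -> (y q <= y p)%N -> f (swap_positions p q y) <= f y.
Proof.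
move=> pq neq_pq; rewrite leq_eqVlt => /orP[/eqP/val_inj eq_y|lt_y].
  suff -> : swap_positions p q y = y by [].
  by apply/ffunP=> b; rewrite ffunE; case: tpermP => // ->.
(* Here both [p] and [q] sit at [y q]; raising [p] to [y p] gives back [y], raising [q] instead
   gives the swap. *)
have := pq _ _ lt_y (reassign y p (y q)).
rewrite !ffunE eqxx eq_sym (negbTE neq_pq) => /(_ erefl erefl).
congr (f _ <= f _); apply/ffunP=> b; rewrite !ffunE.
  by case: tpermP => [->|->|/eqP/negbTE -> /eqP/negbTE ->];
    rewrite ?eqxx ?(negbTE neq_pq).
by case: eqVneq => [->|].
Qed.

(* When the swap itself goes the wrong way, moving [q] to the position of [p]
   makes the allocation symmetric and monotonicity applies. *)
Lemma swap_dominated p q y : succeq f p q -> p != q ->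
  exists2 y' : allocation n m, (forall b, b != p -> y' b = swap_positions p q y b)
            & f y' <= f y.
Proof.
move=> pq neq_pq; case: (leqP (y q) (y p)) => [le_y|lt_y].
  by exists (swap_positions p q y) => //; apply: swap_positions_le.
exists (reassign y q (y p)) => [b neq_bp|].
  by rewrite !ffunE; case: tpermP neq_bp => [->||/eqP _ /eqP/negbTE ->];
    rewrite ?eqxx // => -> _; rewrite eqxx.
apply: ladder_monotonic => b; rewrite ffunE.
by case: eqVneq => // ->; apply: ltnW.
Qed.

Lemma swap_dominating p q y : succeq f p q -> p != q ->
  exists2 y' : allocation n m, (forall b, b != p -> y' b = swap_positions p q y b)
            & f y <= f y'.
Proof.
move=> pq neq_pq; case: (leqP (y p) (y q)) => [le_y|lt_y].
  exists (swap_positions p q y) => //.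
  (* By involutivity [y] is the swap of an allocation that places [p] at least as high as [q]. *)
  rewrite -{1}(swap_positionsK p q y); apply: swap_positions_le => //.
  by rewrite !ffunE tpermL tpermR.
exists (reassign y q (y p)) => [b neq_bp|].
  by rewrite !ffunE; case: tpermP neq_bp => [->||/eqP _ /eqP/negbTE ->];
    rewrite ?eqxx // => -> _; rewrite eqxx.
apply: ladder_monotonic => b; rewrite ffunE.
by case: eqVneq => // ->; apply: ltnW.
Qed.

(** Any completion [y] of the swapped allocation is compared with a completion [y'] of [x], of value
    at most [f y] to transfer [always_ge] and at least [f y] to transfer [always_lt]. Control of
    [y'] away from [p] suffices, as [p] lies outside [S]. *)
Lemma decided_swap p q S x : succeq f p q -> q \in S -> p \notin S ->
  decided S x -> decided (tperm p q @^-1: S) (swap_positions p q x).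
Proof.
move=> pq qS pS.
have neq_pq : p != q by apply: contraNneq pS => ->.
have agreeS y (y' : allocation n m) : agree (tperm p q @^-1: S) (swap_positions p q x) y ->
    (forall b, b != p -> y' b = swap_positions p q y b) -> agree S x y'.
  move=> /agreeP xy y'E; apply/agreeP=> b bS.
  rewrite y'E; last by apply: contraNneq pS => <-.
  by rewrite ffunE xy ?inE ?ffunE tpermK.
move=> /orP[/always_geP geS|/always_ltP ltS]; apply/orP; [left|right].
  apply/always_geP=> y xy; have [y' y'E] := swap_dominated p q y pq neq_pq.
  exact/le_trans/geS/(agreeS y).
apply/always_ltP=> y xy; have [y' y'E] := swap_dominating p q y pq neq_pq.
by move=> /le_lt_trans; apply; apply/ltS/(agreeS y).
Qed.

(** * Counting decided ordered allocations *)

Definition upto s a : {set 'I_n} := [set b | (s b <= s a)%N].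
Definition before s a : {set 'I_n} := [set b | (s b < s a)%N].

Definition decided_upto a := [set Q | decided (upto Q.1 a) Q.2].
Definition decided_before a := [set Q | decided (before Q.1 a) Q.2].

Lemma decided_before_subset a : decided_before a \subset decided_upto a.
Proof.
apply/subsetP=> Q; rewrite !inE; apply: decided_subset.
by apply/subsetP=> b; rewrite !inE; apply: ltnW.
Qed.

Definition exchange p q Q : ordered_allocation n m :=
  ((tperm p q * Q.1)%g,
   if (Q.1 q < Q.1 p)%N then swap_positions p q Q.2 else Q.2).

(** The new order determines the old one, hence also the branch of the [if], and each branch is
    injective in the positions. *)
Lemma exchange_inj p q : injective (exchange p q).
Proof.
move=> [s x] [t y] [/mulgI <-] /=; case: ifP => _; last by move=> ->.
by move=> /(can_inj (swap_positionsK p q)) ->.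
Qed.

Lemma tperm_preimset p q S :
  (p \in S) = (q \in S) -> tperm p q @^-1: S = S.
Proof. by move=> pq; apply/setP=> b; rewrite inE; case: tpermP => [->|->|]. Qed.

Lemma upto_tperm p q s : upto (tperm p q * s)%g p = tperm p q @^-1: upto s q.
Proof. by apply/setP=> b; rewrite !inE !permM tpermL. Qed.

Lemma before_tperm p q s :
  before (tperm p q * s)%g q = tperm p q @^-1: before s p.
Proof. by apply/setP=> b; rewrite !inE !permM tpermR. Qed.

Lemma leq_decided_upto p q : succeq f p q ->
  (#|decided_upto q| <= #|decided_upto p|)%N.
Proof.
move=> pq; rewrite -(card_imset _ (exchange_inj p q)).
apply/subset_leq_card/subsetP=> _ /imsetP[[s x] + ->].
rewrite !inE /= upto_tperm; case: ltnP => [lt_qp|le_pq].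
  by apply: decided_swap => //; rewrite inE // -ltnNge.
(* Both players lie in [upto s q], so the transposition fixes this set. *)
by rewrite tperm_preimset // !inE leqnn.
Qed.

Lemma leq_decided_before p q : succeq f p q ->
  (#|decided_before p| <= #|decided_before q|)%N.
Proof.
move=> pq; rewrite -(card_imset _ (exchange_inj p q)).
apply/subset_leq_card/subsetP=> _ /imsetP[[s x] + ->].
rewrite !inE /= before_tperm; case: ltnP => [lt_qp|le_pq].
  by apply: decided_swap => //; rewrite inE // ltnn.
(* Neither player lies in [before s p]. *)
by rewrite tperm_preimset // !inE ltnn ltnNge le_pq.
Qed.

Lemma mem_consistent Q a t y :
  ((t, y) \in consistent Q a) = (t == Q.1) && agree (upto Q.1 a) Q.2 y.
Proof.
by rewrite inE /agree; congr (_ && _); apply: eq_forallb => b; rewrite inE.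
Qed.

Lemma forall_consistent (P : pred (allocation n m)) Q a :
  [forall Q' in consistent Q a, P Q'.2]
    = [forall y, agree (upto Q.1 a) Q.2 y ==> P y].
Proof.
apply/forall_inP/forall_inP => PQ.
  by move=> y xy; apply: (PQ (Q.1, y)); rewrite mem_consistent eqxx.
by move=> [t y]; rewrite mem_consistent => /andP[_]; apply: PQ.
Qed.

Lemma upto_prec s a : s a != 0 :> nat -> upto s (prec s a) = before s a.
Proof.
move=> sa0; apply/setP=> b; rewrite !inE prec_rank //.
by rewrite -[in RHS](prednK (n := s a)) ?lt0n.
Qed.

Lemma before_first s a : s a = 0 :> nat -> before s a = set0.
Proof. by move=> sa0; apply/setP=> b; rewrite !inE sa0. Qed.

End Decided.

(** * Pivotality as a change from undecided to decided *)

Section Pivotal.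
Context {R : realType} {n m : nat} (f : game_ladder R n m) (i : nat).
Hypothesis hi : (1 <= i <= (nvalues f).-1)%N.

Lemma threshold_attained : exists y, z f i <= f y.
Proof.
have : z f i \in codom f.
  rewrite -mem_values mem_nth // -/(nvalues f).
  by case/andP: hi; case: (i) (nvalues f) => // j [|k] //= _ /ltnW.
by move=> /codomP[y ->]; exists y.
Qed.

Lemma threshold_missed : exists y, f y < z f i.
Proof.
case/andP: hi => i_gt0 ltik.
have lti : (i < nvalues f)%N by case: (nvalues f) ltik i_gt0 => //; case: (i).
(* Counting from 0, entry [i] is the value $z_{i+1}$, the next one below $z_i$. *)
have : nth 0 (values f) i \in codom f by rewrite -mem_values mem_nth.
move=> /codomP[y yE]; exists y; rewrite -yE /z.
have := @sorted_ltn_nth _ >%R _ 0 _ (values_decreasing f) i.-1 i.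
rewrite !inE; apply; rewrite ?prednK //.
  by move=> u v w vu /lt_trans; apply.
exact: ltnW.
Qed.

(** This accounts for the first player, before whom nobody has acted: the threshold is both attained
    and missed, so nothing is settled yet. *)
Lemma undecided_set0 x : decided f (z f i) set0 x = false.
Proof.
have agree0 y : agree set0 x y by apply/agreeP=> b; rewrite inE.
apply/negP=> /orP[/always_geP ge_z|/always_ltP lt_z].
  by have [y] := threshold_missed; rewrite ltNge ge_z.
by have [y] := threshold_attained; rewrite leNgt lt_z.
Qed.

Lemma RplusE a : Rplus f i a =
  decided_upto f (z f i) a :\: decided_before f (z f i) a.
Proof.
apply/setP=> -[s x]; rewrite !inE /pivotal /=.
have existsN (P : pred (allocation n m)) b :
    [exists Q' in consistent (s, x) b, P Q'.2]
      = ~~ [forall Q' in consistent (s, x) b, ~~ P Q'.2].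
  by rewrite negb_forall_in; apply: eq_existsb => Q'; rewrite negbK.
rewrite (existsN (fun y => f y < z f i)) (existsN (fun y => z f i <= f y)).
rewrite (forall_consistent (fun y => z f i <= f y)).
rewrite (forall_consistent (fun y => f y < z f i)).
rewrite (forall_consistent (fun y => ~~ (f y < z f i))).
rewrite (forall_consistent (fun y => ~~ (z f i <= f y))) /=.
under [X in _ ==> ~~ X]eq_forallb do rewrite -leNgt.
under [X in _ || (_ && (_ ==> ~~ X))]eq_forallb do rewrite -ltNge.
rewrite -!/(always_ge _ _ _ _) -!/(always_lt _ _ _ _).
have [sa0|sa0] := eqVneq (s a : nat) 0%N.
  by rewrite before_first // undecided_set0 !andbT.
rewrite /= upto_prec // /decided negb_or.
(* An outcome settled one way after [a] was not settled the other way before, so excluding the same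
   way before [a] amounts to being undecided there. *)
case geU: (always_ge _ _ (upto s a) x) => /=.
  by rewrite !(always_ge_ltF _ _ _ _ _ geU) orbF !andbT.
case ltU: (always_lt _ _ (upto s a) x); rewrite /= ?andbF //.
have -> : always_ge f (z f i) (before s a) x = false.
  by apply: contraTF ltU => /always_ge_ltF ->.
by rewrite andbT.
Qed.

End Pivotal.

Theorem theorem2 (R : realType) (n m : nat) (f : game_ladder R n m)
    (p q : 'I_n) (hpq : succeq f p q) (i : nat)
    (hi : (1 <= i <= (nvalues f).-1)%N) :
  (#|Rplus f i q| <= #|Rplus f i p|)%N.
Proof.
rewrite !RplusE // !cardsD !(setIidPr (decided_before_subset _ _ _)).
exact: leq_sub (leq_decided_upto _ _ _ _ hpq) (leq_decided_before _ _ _ _ hpq).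
Qed.
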